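(* Fix $m\in[M]$, $\boldsymbol x^*\in\mathcal X$, and $\epsilon>0$. Suppose the regularity assumption and the light-tail domination assumption (both in the context) hold, and the column generation algorithm (in the context) reaches a feasible restricted PMP at some finite iteration $l_0$. From iteration $l_0$ onward, suppose every restricted PMP primal–dual pair is solved globally, every PSP value is computed exactly, and all generated columns are retained. For $l\ge l_0$, define $$\rho_l(\boldsymbol a):=f_m(\boldsymbol a,\boldsymbol x^* )-\alpha_m^{*(l)}-\sum_{t\in[T_m]}\beta_{mt}^{*(l)}g_t(\boldsymbol a),$$ where $(\alpha_m^{*(l)},\boldsymbol\beta_m^{*(l)})$ is the optimal dual solution of the restricted PMP at iteration $l$. For $R>0$, define $K_R:=\{\boldsymbol a\in\mathcal A_m:g_{t_0}(\boldsymbol a)\le R\}$ (which is compact). Assume that for some $R>0$, $$\sup_{l\ge l_0}\ \sup_{\boldsymbol a\in\mathcal A_m:\,g_{t_0}(\boldsymbol a)>R}\rho_l(\boldsymbol a)\le\epsilon/2$$ and the family $\{\rho_l|_{K_R}\}_{l\ge l_0}$ is equicontinuous. Then the algorithm terminates in finitely many iterations and returns an $\epsilon/2$-optimal solution to the subproblem $\Omega_m^*(\boldsymbol x^* )=\sup_{\mathbb P\in\mathcal P_m}\mathbb E_{\mathbb P}[f_m(\boldsymbol a_m,\boldsymbol x^* )]$. Specifically, the returned distribution $\mathbb P_m^{\mathrm{PMP}}\in\mathcal P_m$ and value $\omega_m^*(\boldsymbol x^* )$ satisfy $$\Omega_m^*(\boldsymbol x^* )-\epsilon/2\le\omega_m^*(\boldsymbol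 x^* )=\mathbb E_{\mathbb P_m^{\mathrm{PMP}}}[f_m(\boldsymbol a_m,\boldsymbol x^* )]\le\Omega_m^*(\boldsymbol x^* ).$$
   Context: $[M]=\{1,\dots,M\}$, $\mathcal X\subseteq\mathbb R^n$. For each $m\in[M]$: $\mathcal A_m\subseteq\mathbb R^n$ carries its Borel $\sigma$-algebra $\mathcal F_m$; $f_m:\mathcal A_m\times\mathcal X\to\mathbb R$; and, for finitely many measurable $g_t:\mathcal A_m\to\mathbb R$, $t\in[T_m]$ (possibly depending on $m$), and $\gamma_{mt}\in\mathbb R$, $$\mathcal P_m=\{\mathbb P \text{ nonnegative measure on }(\mathcal A_m,\mathcal F_m):\ \mathbb P(\mathcal A_m)=1,\ \mathbb E_{\mathbb P}[g_t^-]<\infty,\ \mathbb E_{\mathbb P}[g_t]\le\gamma_{mt}\ \forall t\in[T_m]\},\quad g_t^-=\max\{-g_t,0\}.$$ **Regularity assumption.** For each $m$, $\mathcal P_m\neq\varnothing$ and: (i) $\mathcal A_m$ is nonempty and closed, $f_m(\cdot,\boldsymbol x)$ is upper semicontinuous on $\mathcal A_m$ for every $\boldsymbol x\in\mathcal X$, and each $g_t$ is lower semicontinuous; (ii) for every $\boldsymbol x\in\mathcal X$ there are scalars $\beta_{0m}(\boldsymbol x)\in\mathbb R$, $\beta_{tm}(\boldsymbol x)\ge0$ with $|f_m(\boldsymbol a,\boldsymbol x)|\le\beta_{0m}(\boldsymbol x)+\sum_{t\in[T_m]}\beta_{tm}(\boldsymbol x)|g_t(\boldsymbol a)|$ for all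 $\boldsymbol a\in\mathcal A_m$. **Light-tail domination assumption.** For each $m$, each $g_t$ is continuous on $\mathcal A_m$, and there is an index $t_0\in[T_m]$ such that $g_{t_0}$ is nonnegative and coercive on $\mathcal A_m$ ($g_{t_0}(\boldsymbol a)\to\infty$ as $\|\boldsymbol a\|\to\infty$, $\boldsymbol a\in\mathcal A_m$) and, for every $\boldsymbol x\in\mathcal X$, $|f_m(\boldsymbol a,\boldsymbol x)|/g_{t_0}(\boldsymbol a)\to0$ and $|g_t(\boldsymbol a)|/g_{t_0}(\boldsymbol a)\to0$ for all $t\in[T_m]\setminus\{t_0\}$, as $g_{t_0}(\boldsymbol a)\to\infty$. **Column generation algorithm.** Input: row $m$, decision $\boldsymbol x^*$, tolerance $\epsilon>0$, finite scenario set $\hat A_m=\{\boldsymbol a_{mk}:k=0,\dots,K_m\}\subseteq\mathcal A_m$; counter $l=0$. - Step 3.1 (pricing master problem, PMP): solve the linear program $$\omega_m^*(\boldsymbol x^* )=\max_{P_{mk}\ge0}\sum_{k=0}^{K_m}P_{mk}f_m(\boldsymbol a_{mk},\boldsymbol x^* )\ \text{ s.t. }\ \sum_{k=0}^{K_m}P_{mk}=1,\ \sum_{k=0}^{K_m}P_{mk}g_t(\boldsymbol a_{mk})\le\gamma_{mt}\ \forall t\in[T_m].$$ If it is infeasible, take a dual Farkas ray $(\alpha_m^*,\boldsymbol\beta_m^* )$, $\boldsymbol\beta_m^*\ge\boldsymbol0$ (i.e. $\alpha_m^*+\sum_t\beta_{mt}^*g_t(\boldsymbol a_{mk})\ge0$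 for all $k$ and $\alpha_m^*+\sum_t\beta_{mt}^*\gamma_{mt}<0$), choose any $\tilde{\boldsymbol a}_m\in\mathcal A_m$ with $-\alpha_m^*-\sum_t\beta_{mt}^*g_t(\tilde{\boldsymbol a}_m)>0$, add it to $\hat A_m$, set $l\leftarrow l+1$, and repeat Step 3.1. Otherwise let $\{P_{mk}^*\}$ be an optimal primal solution and $(\alpha_m^*,\boldsymbol\beta_m^* )$ an optimal solution of the LP dual: $\min\{\alpha+\sum_t\beta_t\gamma_{mt}:\ \alpha+\sum_t\beta_tg_t(\boldsymbol a_{mk})\ge f_m(\boldsymbol a_{mk},\boldsymbol x^* )\ \forall k,\ \alpha\in\mathbb R,\ \boldsymbol\beta\ge\boldsymbol0\}$. - Step 3.2 (pricing subproblem, PSP): compute $\pi_m^*=\sup_{\tilde{\boldsymbol a}_m\in\mathcal A_m}\{f_m(\tilde{\boldsymbol a}_m,\boldsymbol x^* )-\alpha_m^*-\sum_{t\in[T_m]}\beta_{mt}^*g_t(\tilde{\boldsymbol a}_m)\}$. - Step 3.3: If $\pi_m^*\le\epsilon/2$, stop and return $\mathbb P_m^{\mathrm{PMP}}:=\sum_{k=0}^{K_m}P_{mk}^*\delta_{\boldsymbol a_{mk}}$ and $\omega_m^*(\boldsymbol x^* )$. Otherwise choose any $\tilde{\boldsymbol a}_m\in\mathcal A_m$ whose reduced cost $f_m(\tilde{\boldsymbol a}_m,\boldsymbol x^* )-\alpha_m^*-\sum_t\beta_{mt}^*g_t(\tilde{\boldsymbol a}_m)$ exceeds $\epsilon/2$,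 add it to $\hat A_m$, set $l\leftarrow l+1$, and return to Step 3.1. *)

(* Defs.v *)
From HB Require Import structures.
From mathcomp Require Import all_boot all_order all_algebra.
From mathcomp Require Import all_classical all_reals all_analysis.

Set Implicit Arguments.
Unset Strict Implicit.
Unset Printing Implicit Defensive.

Import Order.TTheory GRing.Theory Num.Theory.
Import numFieldNormedType.Exports.

Local Open Scope classical_set_scope.
Local Open Scope ring_scope.

(* R^n with its Borel sigma-algebra; 'rV[R]_n carries the sup-norm topology. *)
Definition borel_rV (R : realType) (n : nat) :=
  g_sigma_algebraType (@open 'rV[R]_n).

Section Limits.
Context {R : realType} {n : nat}.
Implicit Types (A : set 'rV[R]_n) (h : 'rV[R]_n -> R).

(* The filter "h a --> +oo with a in A".  When h is bounded on A it contains
   set0, so that any limit along it holds vacuously. *)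
Definition growing A h : set_system 'rV[R]_n :=
  filter_from [set: R] (fun c => [set a | A a /\ c < h a]).

Global Instance growing_filter A h : Filter (growing A h).
Proof.
apply: filter_from_filter; first by exists 0.
move=> c d _ _; exists (Num.max c d) => // a [Aa].
by rewrite gt_max => /andP[ca da]; split; split.
Qed.

(* In the topology of `subspace A` the points outside A are isolated, so both
   notions below only constrain h on A, in the topology induced on A. *)
Definition lsc_on A h : Prop :=
  lower_semicontinuous (fun a : subspace A => (h a)%:E).

Definition usc_on A h : Prop :=
  forall (a : subspace A) (c : R), h a < c -> \forall b \near a, h b < c.

End Limits.

(* The data attached to one row m: the set A_m, the reward f_m(a, x), and the
   moment functions g_t with their bounds gamma_{mt}, t < T_m.  Functions on
   A_m are represented by total functions, only used on A_m. *)
Record row_data (R : realType) (n : nat) := RowData {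
  supp : set 'rV[R]_n ;
  reward : 'rV[R]_n -> 'rV[R]_n -> R ;
  nmom : nat ;
  mom : 'I_nmom -> 'rV[R]_n -> R ;
  bnd : 'I_nmom -> R ;
  mom_measurable : forall t,
    measurable_fun (supp : set (borel_rV R n)) (mom t : borel_rV R n -> R)
}.

Arguments mom {R n} _ _ _.
Arguments bnd {R n} _ _.

Section Row.
Context {R : realType} {n : nat}.
Variable (w : row_data R n).
Implicit Types (X : set 'rV[R]_n) (x a : 'rV[R]_n).
Implicit Types (s : seq 'rV[R]_n) (p q : nat -> {nonneg R}).
Implicit Types (alpha : R) (beta : 'I_(nmom w) -> R).

(* A measure on (A_m, F_m) is represented by the measure on Borel sets
   of R^n that it induces, i.e. one that does not charge the complement of A_m.
   The bound on the negative part makes the integral of g_t meaningful. *)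
Definition ambiguity (P : {measure set (borel_rV R n) -> \bar R}) : Prop :=
  [/\ P (~` supp w) = 0%E,
      P (supp w) = 1%E,
      forall t, (\int[P]_(a in supp w) (Num.max (- mom w t a) 0)%:E < +oo)%E
    & forall t, (\int[P]_(a in supp w) (mom w t a)%:E <= (bnd w t)%:E)%E].

Definition expected_reward (P : {measure set (borel_rV R n) -> \bar R}) x :
    \bar R :=
  (\int[P]_(a in supp w) (reward w a x)%:E)%E.

Definition Omega x : \bar R :=
  ereal_sup [set expected_reward P x | P in ambiguity].

Definition regularity X : Prop :=
  [/\ (exists P, ambiguity P),
      supp w !=set0 /\ closed (supp w),
      forall x, X x -> usc_on (supp w) (fun a => reward w a x),
      forall t : 'I_(nmom w), lsc_on (supp w) (mom w t)
    & forall x, X x -> exists (b0 : R) (b : 'I_(nmom w) -> R),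
        (forall t, 0 <= b t) /\
        (forall a, supp w a ->
           `|reward w a x| <= b0 + \sum_(t < nmom w) b t * `|mom w t a|)].

Definition light_tail X (t0 : 'I_(nmom w)) : Prop :=
  [/\ forall t : 'I_(nmom w), {within supp w, continuous (mom w t)},
      forall a, supp w a -> 0 <= mom w t0 a,
      mom w t0 a @[a --> growing (supp w) (fun a => `|a|)] --> +oo,
      forall x, X x ->
        `|reward w a x| / mom w t0 a @[a --> growing (supp w) (mom w t0)] --> 0
    & forall t : 'I_(nmom w), t != t0 ->
        `|mom w t a| / mom w t0 a @[a --> growing (supp w) (mom w t0)] --> 0].

(* The restricted linear programs.  The scenario set is the list s; the weight
   of its k-th element s`_k is p k, and p k is irrelevant for k >= size s. *)

Definition pmp_obj s x p : R :=
  \sum_(k < size s) (p k)%:num * reward w s`_k x.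

Definition pmp_feasible s p : Prop :=
  \sum_(k < size s) (p k)%:num = 1 /\
  forall t : 'I_(nmom w), \sum_(k < size s) (p k)%:num * mom w t s`_k <= bnd w t.

Definition pmp_optimal s x p : Prop :=
  pmp_feasible s p /\ forall q, pmp_feasible s q -> pmp_obj s x q <= pmp_obj s x p.

Definition pmp_value s x : \bar R :=
  ereal_sup [set (pmp_obj s x p)%:E | p in pmp_feasible s].

Definition dual_obj alpha beta : R := alpha + \sum_(t < nmom w) beta t * bnd w t.

Definition dual_feasible s x alpha beta : Prop :=
  (forall a, a \in s ->
     reward w a x <= alpha + \sum_(t < nmom w) beta t * mom w t a) /\
  forall t, 0 <= beta t.

Definition dual_optimal s x alpha beta : Prop :=
  dual_feasible s x alpha beta /\
  forall alpha' beta', dual_feasible s x alpha' beta' ->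
    dual_obj alpha beta <= dual_obj alpha' beta'.

Definition farkas_ray s alpha beta : Prop :=
  [/\ forall t, 0 <= beta t,
      forall a, a \in s -> 0 <= alpha + \sum_(t < nmom w) beta t * mom w t a
    & dual_obj alpha beta < 0].

Definition reduced_cost x alpha beta a : R :=
  reward w a x - alpha - \sum_(t < nmom w) beta t * mom w t a.

Definition psp_value x alpha beta : \bar R :=
  ereal_sup [set (reduced_cost x alpha beta a)%:E | a in supp w].

Definition pmp_measure s p : {measure set (borel_rV R n) -> \bar R} :=
  msum (fun k => mscale (p k) (dirac (s`_k : borel_rV R n))) (size s).

Definition sublevel (t0 : 'I_(nmom w)) (r : R) : set 'rV[R]_n :=
  [set a | supp w a /\ mom w t0 a <= r].

End Row.

(* Everything the algorithm produces, indexed by the iteration counter l.  At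
   iteration l: `scen l` is the current scenario list, (`dual_a l`, `dual_b l`)
   is the dual solution, or the Farkas ray when the master problem is
   infeasible, `weight l` is the primal solution, and `column l` is the added
   scenario.  Values at iterations that are not executed are meaningless. *)
Record cg_trace (R : realType) (n : nat) (w : row_data R n) := CGTrace {
  scen : nat -> seq 'rV[R]_n ;
  weight : nat -> nat -> {nonneg R} ;
  dual_a : nat -> R ;
  dual_b : nat -> 'I_(nmom w) -> R ;
  column : nat -> 'rV[R]_n
}.

Section Run.
Context {R : realType} {n : nat} {w : row_data R n}.
Variables (x : 'rV[R]_n) (eps : R) (c : cg_trace w).

Definition master_feasible (l : nat) : Prop := exists p, pmp_feasible w (scen c l) p.

Definition rho (l : nat) (a : 'rV[R]_n) : R :=
  reduced_cost x (dual_a c l) (dual_b c l) a.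

Definition stops_at (l : nat) : Prop :=
  master_feasible l /\
  (psp_value x (dual_a c l) (dual_b c l) <= (eps / 2)%:E)%E.

Definition executed (l : nat) : Prop :=
  forall k, (k < l)%N -> ~ stops_at k.

Definition adds_column (l : nat) : Prop :=
  supp w (column c l) /\ scen c l.+1 = rcons (scen c l) (column c l).

(* c is a complete (terminating or infinite) execution of the column generation
   algorithm at decision x with tolerance eps. *)
Definition cg_run : Prop :=
  [/\ scen c 0 != [::],
      forall a, a \in scen c 0 -> supp w a,
      forall l, executed l -> ~ master_feasible l ->
        [/\ farkas_ray (scen c l) (dual_a c l) (dual_b c l),
            0 < - dual_a c l
                - \sum_(t < nmom w) dual_b c l t * mom w t (column c l)
          & adds_column l],
      forall l, executed l -> master_feasible l ->
        pmp_optimal w (scen c l) x (weight c l) /\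
        dual_optimal (scen c l) x (dual_a c l) (dual_b c l)
    & forall l, executed l -> master_feasible l -> ~ stops_at l ->
        eps / 2 < rho l (column c l) /\ adds_column l].

End Run.

(* Main.v *)
(* If the run never stopped, the columns a_l would stay in a compact sublevel
   set of g_{t0} and satisfy rho_l(a_l) > eps/2, whereas dual feasibility at
   retained columns gives rho_j(a_i) <= 0 for i < j; this contradicts
   equicontinuity at a cluster point of (a_l).  At the stopping iteration,
   f <= alpha + sum_t beta_t g_t + eps/2 on the support, so integrating bounds
   Omega by the dual value plus eps/2, and the dual value is the primal one by
   LP duality, a consequence of Farkas' lemma. *)
Require Import Defs.
From HB Require Import structures.
From mathcomp Require Import all_boot all_order all_algebra.
From mathcomp Require Import all_classical all_reals all_analysis.
From mathcomp Require Import measurable_realfun lra.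
Import Order.TTheory GRing.Theory Num.Theory.
Import numFieldNormedType.Exports.
Local Open Scope classical_set_scope.
Local Open Scope ring_scope.

(** * Farkas' lemma and strong duality for the restricted master problem *)

(* Bartl's induction on the number of constraints: if dropping the first
   constraint a breaks the implication at some point y, then a y > 0 and
   the remaining constraints can be projected along y onto the kernel of a. *)
Lemma farkas (F : realFieldType) (m N : nat) (A : 'M[F]_(m, N)) (b : 'rV[F]_N) :
  (forall y : 'cV[F]_N,
     (forall i, (A *m y) i ord0 <= 0) -> (b *m y) ord0 ord0 <= 0) ->
  exists2 l : 'rV[F]_m, (forall i, 0 <= l ord0 i) & b = l *m A.
Proof.
elim: m A b => [|m IHm] A b Ab.
  exists 0 => [i|]; first by rewrite mxE.
  rewrite mul0mx; apply/rowP => j; rewrite mxE.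
  (* With no constraints, the test vector [b^T] makes the sum of squares of the entries of [b]
     nonpositive. *)
  have : (b *m b^T) ord0 ord0 <= 0 by apply: Ab => -[].
  rewrite mxE => bb0; have sq_ge0 k : 0 <= b ord0 k * b^T k ord0.
    by rewrite mxE -expr2 sqr_ge0.
  have /eqP : \sum_k b ord0 k * b^T k ord0 = 0.
    by apply/le_anti; rewrite bb0 sumr_ge0.
  rewrite psumr_eq0// => /allP/(_ j); rewrite mem_index_enum => /(_ isT).
  by rewrite /= mxE mulf_eq0 orbb => /eqP.
rewrite -[m.+1]/(1 + m)%N in A b Ab *.
rewrite -[A]vsubmxK in Ab *.
move: (usubmx A) (dsubmx A) Ab => a B Ab.
have [Bb|] := pselect (forall y : 'cV[F]_N,
    (forall i, (B *m y) i ord0 <= 0) -> (b *m y) ord0 ord0 <= 0).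
  have [l l0 ->] := IHm B b Bb.
  exists (row_mx 0 l) => [i|]; last by rewrite mul_row_col mul0mx add0r.
  by case: (split_ordP i) => j ->; rewrite ?row_mxEl ?row_mxEr// mxE.
move=> /existsNP[y /not_implyP[By /negP]]; rewrite -ltNge => by_gt0.
have ay_gt0 : 0 < (a *m y) ord0 ord0.
  rewrite ltNge; apply/negP => ay_le0.
  move: by_gt0; rewrite ltNge => /negP; apply.
  apply: Ab => i; rewrite mul_col_mx.
  by case: (split_ordP i) => j ->; rewrite ?col_mxEu ?col_mxEd// !ord1.
set t := (a *m y) ord0 ord0 in ay_gt0.
pose z := t^-1 *: y.
have az : a *m z = 1%:M.
  by rewrite -scalemxAr [a *m y]mx11_scalar scale_scalar_mx mulVf// gt_eqF.
have bz_gt0 : 0 < (b *m z) ord0 ord0.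
  by rewrite -scalemxAr mxE mulr_gt0// invr_gt0.
have Bz i : (B *m z) i ord0 <= 0.
  by rewrite -scalemxAr mxE pmulr_rle0// invr_gt0.
have projE k (C : 'M[F]_(k, N)) y' :
    (C - C *m z *m a) *m y' = C *m (y' - z *m (a *m y')).
  by rewrite mulmxBl mulmxBr !mulmxA.
have [|l l0 /eqP] := IHm (B - B *m z *m a) (b - b *m z *m a).
  move=> y'; rewrite !projE => By'; apply: Ab => i; rewrite mul_col_mx.
  case: (split_ordP i) => j ->; rewrite ?col_mxEu ?col_mxEd//.
  by rewrite mulmxBr !mulmxA az mul1mx subrr mxE.
rewrite subr_eq => /eqP bE.
(* Expanding the projected identity gives [b = (b z - l B z) a + l B]; the coefficient of [a] is
   nonnegative since [b z > 0], [B z <= 0] and [l >= 0]. *)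
exists (row_mx (b *m z - l *m B *m z) l) => [i|].
  case: (split_ordP i) => j ->; rewrite ?row_mxEl ?row_mxEr//.
  rewrite !ord1 mxE addr_ge0 ?(ltW bz_gt0)// mxE oppr_ge0 -mulmxA mxE.
  by apply: sumr_le0 => k _; rewrite mulr_ge0_le0.
rewrite mul_row_col mulmxBl [LHS]bE mulmxBr !mulmxA.
by rewrite addrC addrCA addrC -addrA addrC.
Qed.

(** Farkas' lemma turns optimality of the dual solution into multipliers of the dual constraints,
    and these multipliers are the primal weights. *)
Lemma pmp_strong_duality (R : realType) (n : nat) (w : row_data R n)
    (s : seq 'rV[R]_n) (x : 'rV[R]_n) (alpha : R) (beta : 'I_(nmom w) -> R) :
  dual_optimal s x alpha beta ->
  exists2 p, pmp_feasible w s p & dual_obj alpha beta <= pmp_obj w s x p.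
Proof.
move=> [[dfeas beta0] dmin]; set v := dual_obj alpha beta in dmin *.
(* The columns stand for (alpha', beta', tau), where tau homogenizes the
   constraints of the dual; the last rows say that beta', tau >= 0. *)
pose D : 'M[R]_(size s, nmom w + 1) :=
  row_mx (\matrix_(k, t) - mom w t s`_k) (\col_k reward w s`_k x).
pose A : 'M[R]_(size s + (nmom w + 1), 1 + (nmom w + 1)) :=
  col_mx (row_mx (const_mx (-1)) D) (row_mx 0 (- 1%:M)).
pose b : 'rV[R]_(1 + (nmom w + 1)) :=
  row_mx (const_mx (-1)) (row_mx (\row_t - bnd w t) (const_mx v)).
have [|l l0] := @farkas R _ _ A b.
  move=> y; rewrite -[y]vsubmxK -[dsubmx y]vsubmxK.
  move: (usubmx y) (usubmx (dsubmx y)) (dsubmx (dsubmx y)) => a' b' tau' Ay.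
  pose a : R := a' ord0 ord0; pose be t : R := b' t ord0.
  pose tau : R := tau' ord0 ord0.
  have row_le (k : 'I_(size s)) :
      tau * reward w s`_k x <= a + \sum_t be t * mom w t s`_k.
    have := Ay (lshift _ k); rewrite mul_col_mx col_mxEu !mul_row_col !mxE.
    rewrite !big_ord1 !mxE mulN1r -/a -/tau.
    rewrite [in X in X <= _ -> _](eq_bigr (fun t => - (be t * mom w t s`_k))).
      by rewrite sumrN => h; rewrite mulrC; lra.
    by move=> t _; rewrite !mxE mulNr mulrC.
  have be_ge0 t : 0 <= be t.
    have := Ay (rshift _ (lshift _ t)).
    rewrite mul_col_mx col_mxEd !mul_row_col.
    by rewrite mul0mx add0r mulNmx mul1mx mxE col_mxEu oppr_le0.
  have tau_ge0 : 0 <= tau.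
    have := Ay (rshift _ (rshift _ ord0)).
    rewrite mul_col_mx col_mxEd !mul_row_col.
    by rewrite mul0mx add0r mulNmx mul1mx mxE col_mxEd oppr_le0.
  have tau1_gt0 : 0 < 1 + tau by lra.
  (* Adding the homogenized solution to the optimal dual one and dividing by [1 + tau] stays dual
     feasible, which treats [tau = 0] and [tau > 0] at once. *)
  have : v <= dual_obj ((1 + tau)^-1 * (alpha + a))
                (fun t => (1 + tau)^-1 * (beta t + be t)).
    apply: dmin; split => [c cs|t]; last first.
      by rewrite mulr_ge0 ?invr_ge0 ?(ltW tau1_gt0)// addr_ge0.
    under eq_bigr do rewrite -mulrA.
    rewrite -mulr_sumr -mulrDr ler_pdivlMl//.
    under eq_bigr do rewrite mulrDl.
    rewrite big_split/=; have := dfeas _ cs.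
    have /(nthP 0)[k ks <-] := cs; have := row_le (Ordinal ks).
    by rewrite /=; lra.
  rewrite /dual_obj; under eq_bigr do rewrite -mulrA.
  rewrite -mulr_sumr -mulrDr ler_pdivlMl//.
  under eq_bigr do rewrite mulrDl.
  rewrite big_split/= addrACA -/(dual_obj alpha beta) -/v.
  rewrite !mul_row_col !mxE !big_ord1 !mxE -/a -/tau.
  rewrite [in X in _ -> X <= _](eq_bigr (fun t => - (be t * bnd w t))).
    by rewrite sumrN; lra.
  by move=> t _; rewrite !mxE mulNr mulrC.
(* [p'] holds the scenario multipliers and [q] those of the sign rows. The columns of [b = l A]
   read: total weight 1, moments equal to the bounds minus a slack, objective equal to [v] plus a
   slack. *)
rewrite -[l]hsubmxK in l0 *; move: (lsubmx l) (rsubmx l) l0 => p' q l0.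
have p_ge0 k : 0 <= p' ord0 k by have := l0 (lshift _ k); rewrite row_mxEl.
have q_ge0 k : 0 <= q ord0 k by have := l0 (rshift _ k); rewrite row_mxEr.
rewrite mul_row_col !mul_mx_row mulmx0 mulmxN mulmx1 add_row_mx addr0.
move=> /eq_row_mx[/rowP/(_ ord0) sum1 eqD].
pose p k : {nonneg R} :=
  if insub k is Some i then NngNum (p_ge0 i) else NngNum (lexx (0 : R)).
have pE (k : 'I_(size s)) : (p k)%:num = p' ord0 k by rewrite /p valK.
exists p; last first.
  move/rowP: eqD => /(_ (rshift (nmom w) ord0)).
  rewrite row_mxEr mxE [X in _ = X -> _]mxE row_mxEr !mxE => ->.
  have := q_ge0 (rshift _ ord0); rewrite /pmp_obj => q0.
  under [X in _ <= X]eq_bigr do rewrite pE.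
  under [X in X - _ <= _]eq_bigr do rewrite mxE.
  by rewrite gerBl.
split=> [|t].
  move: sum1; rewrite !mxE; under eq_bigr do rewrite !mxE mulrN1.
  rewrite sumrN => /oppr_inj ->; exact: eq_bigr.
move/rowP: eqD => /(_ (lshift 1 t)).
rewrite row_mxEl mxE [X in _ = X -> _]mxE row_mxEl !mxE.
under eq_bigr do rewrite mxE mulrN.
rewrite sumrN; under [X in _ -> X <= _]eq_bigr do rewrite pE.
have := q_ge0 (lshift _ t); lra.
Qed.

(** * Borel measurability and integration against finitely supported measures *)

Lemma closed_measurable_rV (R : realType) (n : nat) (A : set 'rV[R]_n) :
  closed A -> measurable (A : set (borel_rV R n)).
Proof.
move=> cA; rewrite -[A]setCK; apply: measurableC.
by apply: sub_sigma_algebra; exact: closed_openC.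
Qed.

(** Rays []-oo, c[] generate the Borel sets of the line, and their preimages are relatively open in
    [A], hence traces of open sets. *)
Lemma usc_measurable (R : realType) (n : nat) (A : set 'rV[R]_n)
    (h : 'rV[R]_n -> R) :
  closed A -> usc_on A h ->
  measurable_fun (A : set (borel_rV R n)) (h : borel_rV R n -> R).
Proof.
move=> cA hA; have mA := closed_measurable_rV _ _ _ cA.
apply: (measurability _ (measurable_realfun.RGenInftyO.measurableE R)) => //.
move=> _ [_ [c ->] <-].
have /open_subspaceP[V oV VE] : open ([set a | h a < c] : set (subspace A)).
  by rewrite openE => a /= ac; exact: hA.
have -> : A `&` h @^-1` `]-oo, c[%classic = V `&` A.
  by rewrite VE setIC; congr (_ `&` _);
    apply/seteqP; split => a /=; rewrite in_itv.
by apply: measurableI => //; exact: sub_sigma_algebra.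
Qed.

(** For nonnegative integrands the integral is additive in the measure; positive and negative parts
    then recombine because both integrals are finite. *)
Lemma integral_pmp_measure (R : realType) (n : nat) (s : seq 'rV[R]_n)
    (p : nat -> {nonneg R}) (A : set (borel_rV R n)) (f : borel_rV R n -> R) :
  measurable A -> measurable_fun A f -> (forall a, a \in s -> A a) ->
  (\int[pmp_measure s p]_(a in A) (f a)%:E =
   (\sum_(k < size s) (p k)%:num * f s`_k)%:E)%E.
Proof.
move=> mA mf sA.
have int_ge0 (h : borel_rV R n -> \bar R) : measurable_fun A h ->
    (forall a, A a -> 0 <= h a)%E ->
    (\int[pmp_measure s p]_(a in A) h a =
     \sum_(k < size s) (p k)%:num%:E * h s`_k)%E.
  move=> mh h0; rewrite ge0_integral_measure_sum//; apply: eq_bigr => k _.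
  rewrite ge0_integral_mscale// integral_dirac// diracE mem_set ?mul1e//.
  by apply: sA; exact: mem_nth.
have mEf : measurable_fun A (EFin \o f) by exact/measurable_EFinP.
rewrite integralE !int_ge0//;
  [|exact: measurable_funeneg|exact: measurable_funepos].
under eq_bigr do rewrite funeposE -EFin_max -EFinM.
under [X in (_ - X)%E]eq_bigr do rewrite funenegE -EFinN -EFin_max -EFinM.
rewrite !sumEFin -EFinB -sumrB; congr EFin; apply: eq_bigr => k _.
rewrite -mulrBr; congr (_ * _); have [f0|/ltW f0] := lerP 0 (f s`_k).
  by rewrite (max_idPr _) ?subr0 ?oppr_le0.
by rewrite (max_idPl _) ?sub0r ?opprK ?oppr_ge0.
Qed.

(** * Weak duality over the ambiguity set *)

Section WeakDuality.
Context {R : realType} {n : nat} (w : row_data R n).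
Variable P : {measure set (borel_rV R n) -> \bar R}.
Hypotheses (csupp : closed (supp w)) (Pamb : ambiguity w P).

Let msupp : measurable (supp w : set (borel_rV R n)).
Proof. exact: closed_measurable_rV. Qed.

(** The negative part has finite integral by definition of the ambiguity set, and the upper bound
    [bnd w t] on the whole integral then forces the positive part to be finite too. *)
Lemma integrable_mom (t : 'I_(nmom w)) :
  P.-integrable (supp w : set (borel_rV R n)) (EFin \o mom w t).
Proof.
have [_ _ /(_ t) neg_lty /(_ t) le_bnd] := Pamb.
have mg : measurable_fun (supp w : set (borel_rV R n)) (EFin \o mom w t).
  by apply/measurable_EFinP; exact: mom_measurable.
set g := EFin \o mom w t in mg *.
have gneg_lty : (\int[P]_(a in supp w) g^\- a < +oo)%E.
  by under eq_integral do rewrite funenegE -EFinN -EFin_max.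
have gneg_fin : (\int[P]_(a in supp w) g^\- a)%E \is a fin_num.
  by rewrite ge0_fin_numE// integral_ge0.
have gpos_lty : (\int[P]_(a in supp w) g^\+ a < +oo)%E.
  have : (\int[P]_(a in supp w) g a <= (bnd w t)%:E)%E by [].
  rewrite integralE leeBlDr// => /le_lt_trans; apply.
  by rewrite lte_add_pinfty// ltry.
apply/integrableP; split=> //.
under eq_integral do rewrite -/((abse \o g) _) fune_abse.
rewrite ge0_integralD//; [|exact: measurable_funepos|exact: measurable_funeneg].
exact: lte_add_pinfty.
Qed.

Lemma integrable_cst_supp (k : R) :
  P.-integrable (supp w : set (borel_rV R n)) (cst k%:E).
Proof.
have [_ P1 _ _] := Pamb.
apply/integrableP; split; first exact: measurable_cst.
under eq_integral do rewrite /=.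
by rewrite integral_cst// P1 mule1 ltry.
Qed.

(** Serves twice in weak duality: with [mom w t] for the dual majorant and with its absolute value
    for the growth bound. *)
Lemma integrable_moment_comb (k : R) (b : 'I_(nmom w) -> R)
    (h : 'I_(nmom w) -> borel_rV R n -> \bar R) :
  (forall t, P.-integrable (supp w : set (borel_rV R n)) (h t)) ->
  P.-integrable (supp w : set (borel_rV R n))
    (fun a => k%:E + \sum_(t < nmom w) (b t)%:E * h t a)%E.
Proof.
move=> ih; apply: integrableD => //; first exact: integrable_cst_supp.
by apply: integrable_sum => // t _; exact: integrableZl.
Qed.

(** [delta] is the tolerated violation of the dual constraints on the support: they all hold once
    [alpha] is raised to [alpha + delta]. The growth bound makes the reward integrable. *)
Lemma weak_duality (x : 'rV[R]_n) (alpha delta b0 : R)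
    (beta b : 'I_(nmom w) -> R) :
  usc_on (supp w) (fun a => reward w a x) ->
  (forall a, supp w a ->
     `|reward w a x| <= b0 + \sum_(t < nmom w) b t * `|mom w t a|) ->
  (forall t, 0 <= beta t) ->
  (forall a, supp w a -> reduced_cost x alpha beta a <= delta) ->
  (expected_reward w P x <= (dual_obj alpha beta + delta)%:E)%E.
Proof.
move=> rusc rb beta0 rcd; have [_ P1 _ le_bnd] := Pamb.
pose u (a : borel_rV R n) :=
  ((alpha + delta)%:E + \sum_(t < nmom w) (beta t)%:E * (mom w t a)%:E)%E.
have iu : P.-integrable (supp w : set (borel_rV R n)) u.
  apply: (@integrable_moment_comb _ _ (fun t => EFin \o mom w t)) => t.
  exact: integrable_mom.
have ir : P.-integrable (supp w : set (borel_rV R n))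
    (fun a => (reward w a x)%:E).
  apply: le_integrable (@integrable_moment_comb b0 b
      (fun t => abse \o (EFin \o mom w t)) _) => //.
  - by apply/measurable_EFinP; exact: usc_measurable.
  - move=> a sa; under eq_bigr do rewrite /= -EFinM.
    rewrite sumEFin -EFinD lee_fin (le_trans (rb _ sa))//; exact: ler_norm.
  - by move=> t; apply: integrable_abse => //; exact: integrable_mom.
have le_u : (expected_reward w P x <= \int[P]_(a in supp w) u a)%E.
  apply: le_integral => // a; rewrite inE => sa; rewrite /u.
  under eq_bigr do rewrite -EFinM.
  rewrite sumEFin -EFinD lee_fin.
  by have := rcd _ sa; rewrite /reduced_cost; lra.
apply: (le_trans le_u).
have ib t : P.-integrable (supp w : set (borel_rV R n))
    (fun a => (beta t)%:E * (mom w t a)%:E)%E.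
  by apply: integrableZl => //; exact: integrable_mom.
rewrite /u integralD//; [|exact: integrable_cst_supp|exact: integrable_sum].
rewrite integral_cst// P1 mule1 integral_sum//.
rewrite /dual_obj addrAC [leRHS]EFinD -sumEFin leeD2l// lee_sum// => t _.
rewrite integralZl//; last exact: integrable_mom.
by rewrite EFinM lee_wpmul2l ?lee_fin.
Qed.

End WeakDuality.

(** * Compactness and equicontinuity *)

(** Coercivity bounds the sublevel set; continuity within the closed support makes it closed. *)
Lemma compact_sublevel (R : realType) (n : nat) (w : row_data R n)
    (X : set 'rV[R]_n) (t0 : 'I_(nmom w)) (r : R) :
  closed (supp w) -> light_tail X t0 -> compact (sublevel t0 r).
Proof.
move=> csupp [ctn _ coer _ _]; apply: bounded_closed_compact.
  have /cvgryPgt/(_ r)[c _ cr] := coer.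
  exists c; split; first exact: num_real.
  move=> y cy a [sa ga] /=; rewrite leNgt; apply/negP => ya.
  by have := cr a (conj sa (lt_trans cy ya)); rewrite /= ltNge ga.
have /closed_subspaceP[V cV VE] :
    closed (mom w t0 @^-1` [set y | y <= r] : set (subspace (supp w))).
  by have /continuous_closedP := ctn t0; apply; exact: closed_le.
suff -> : sublevel t0 r = V `&` supp w by exact: closedI.
by rewrite VE setIC.
Qed.

(** Near a cluster point [z] in [K] every [phi l] with [l] in [W] stays within [e / 2] of [phi l z];
    two visits [i < j] to that neighbourhood are compared through [phi j z]. *)
Lemma equicontinuous_compact_pair (R : realType) (T : topologicalType)
    (K : set T) (W : set nat) (phi : nat -> subspace K -> R) (a : nat -> T)
    (l0 : nat) (e : R) :
  compact K -> equicontinuous W phi ->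
  (forall l, (l0 <= l)%N -> W l) -> (forall l, (l0 <= l)%N -> K (a l)) ->
  0 < e ->
  exists i j : nat, [/\ (l0 <= i)%N, (i < j)%N & phi j (a j) - phi j (a i) < e].
Proof.
move=> cK equi Wl Ka e0.
have aK : (a @ \oo) K by exists l0.
have [z [Kz zcl]] := cK _ _ aK.
pose E : set (R * R) := [set xy | ball xy.1 (e / 2) xy.2].
have entE : entourage E.
  by rewrite -entourage_ballE; exists (e / 2) => //=; rewrite divr_gt0.
(* Neighbourhoods of [z] in the subspace are traces on [K], so [E] is controlled only at points of
   [K]. *)
have nz : within K (nbhs z) [set y | forall l, W l -> E (phi l z, phi l y)].
  by rewrite nbhs_subspace_in//; exact: equi.
have hit N : exists2 i, (N <= i)%N & forall l, K (a i) -> W l ->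
    E (phi l z, phi l (a i)).
  have tailN : (a @ \oo) (a @` [set l | (N <= l)%N]).
    by exists N => // l /= Nl; exists l.
  have [_ [[i /= Ni <-] Ui]] := zcl _ _ tailN nz.
  by exists i => // l Kai Wll; exact: Ui.
have [i l0i Ei] := hit l0; have [j ij Ej] := hit i.+1.
have l0j : (l0 <= j)%N by rewrite (leq_trans l0i)// ltnW.
exists i, j; split => //.
have := Ei j (Ka _ l0i) (Wl _ l0j); have := Ej j (Ka _ l0j) (Wl _ l0j).
rewrite /E /ball /= /ball_ !ltr_norml; lra.
Qed.

(** * Primal solutions of the restricted master problem and their measures *)

Lemma pmp_feasible_rcons (R : realType) (n : nat) (w : row_data R n)
    (s : seq 'rV[R]_n) (a : 'rV[R]_n) (p : nat -> {nonneg R}) :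
  pmp_feasible w s p -> exists q, pmp_feasible w (rcons s a) q.
Proof.
move=> [p1 pg].
(* Entries of [p] from index [size s] on are arbitrary, so the new scenario, at index [size s], gets
   an explicit weight 0. *)
pose q k : {nonneg R} := if (k < size s)%N then p k else NngNum (lexx (0 : R)).
have sumE (h : 'rV[R]_n -> R) :
    \sum_(k < size (rcons s a)) (q k)%:num * h (rcons s a)`_k =
    \sum_(k < size s) (p k)%:num * h s`_k.
  rewrite size_rcons big_ord_recr/= /q ltnn mul0r addr0; apply: eq_bigr => k _.
  by rewrite ltn_ord nth_rcons ltn_ord.
exists q; split=> [|t]; last by rewrite sumE.
(* The normalization is the case of [sumE] where [h] is constantly 1. *)
by rewrite -[RHS]p1; have := sumE (fun=> 1); rewrite -!mulr_suml !mulr1.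
Qed.

Lemma pmp_valueE (R : realType) (n : nat) (w : row_data R n)
    (s : seq 'rV[R]_n) (x : 'rV[R]_n) (p : nat -> {nonneg R}) :
  pmp_optimal w s x p -> pmp_value w s x = (pmp_obj w s x p)%:E.
Proof.
move=> [pf pmax]; apply/le_anti/andP; split.
  by apply: ge_ereal_sup => _ [q qf <-]; rewrite lee_fin pmax.
by apply: ereal_sup_ubound; exists p.
Qed.

Lemma ambiguity_pmp_measure (R : realType) (n : nat) (w : row_data R n)
    (s : seq 'rV[R]_n) (p : nat -> {nonneg R}) :
  closed (supp w) -> (forall a, a \in s -> supp w a) -> pmp_feasible w s p ->
  ambiguity w (pmp_measure s p).
Proof.
move=> csupp ssupp [p1 pg].
have msupp := closed_measurable_rV _ _ _ csupp.
have measE (A : set (borel_rV R n)) : pmp_measure s p A =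
    (\sum_(k < size s) (p k)%:num * \1_A s`_k)%:E.
  by rewrite -sumEFin; apply: eq_bigr => k _; rewrite EFinM.
have supp_nth (k : 'I_(size s)) : supp w s`_k by apply: ssupp; exact: mem_nth.
split.
- by rewrite measE big1// => k _; rewrite indicE memNset ?mulr0//=.
- rewrite measE -p1; congr EFin; apply: eq_bigr => k _.
  by rewrite indicE mem_set ?mulr1.
- move=> t; rewrite integral_pmp_measure ?ltry//.
  apply: measurable_maxr; last exact: measurable_cst.
  by apply: measurableT_comp => //; exact: mom_measurable.
- by move=> t; rewrite integral_pmp_measure ?lee_fin//; exact: mom_measurable.
Qed.

(** * Runs of the algorithm and termination *)

Section Run.
Context {R : realType} {n : nat} {w : row_data R n}.
Variables (x : 'rV[R]_n) (eps : R) (c : cg_trace w).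
Hypothesis hrun : cg_run x eps c.

Lemma executed_le (k l : nat) :
  (k <= l)%N -> executed x eps c l -> executed x eps c k.
Proof. by move=> kl el i ik; apply: el; exact: leq_trans kl. Qed.

(** Execution of [l.+1] rules out a stop at [l], so either the Farkas branch or the pricing branch
    appended a column. *)
Lemma executed_adds (l : nat) : executed x eps c l.+1 -> adds_column c l.
Proof.
move=> el1; have el := executed_le _ _ (leqnSn l) el1.
have [_ _ infeas _ opt] := hrun.
have [fl|nfl] := pselect (master_feasible c l).
  by have [] := opt l el fl (el1 l (ltnSn l)).
by have [] := infeas l el nfl.
Qed.

Lemma scen_supp (l : nat) :
  executed x eps c l -> forall a, a \in scen c l -> supp w a.
Proof.
elim: l => [_|l IHl el1 a]; first by case: hrun.
have [sl ->] := executed_adds l el1.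
rewrite mem_rcons in_cons => /predU1P[->//|]; apply: IHl.
exact: executed_le el1.
Qed.

Lemma column_mem (i j : nat) :
  (i < j)%N -> executed x eps c j -> column c i \in scen c j.
Proof.
elim: j => // j IHj; rewrite ltnS leq_eqVlt => ij ej1.
have [_ ->] := executed_adds j ej1; rewrite mem_rcons in_cons.
case/predU1P: ij => [->|ij]; first by rewrite eqxx.
by rewrite IHj ?orbT//; exact: executed_le ej1.
Qed.

Lemma master_feasible_le (i j : nat) :
  (i <= j)%N -> executed x eps c j -> master_feasible c i ->
  master_feasible c j.
Proof.
move=> + + fi; elim: j => [|j IHj]; first by rewrite leqn0 => /eqP <-.
rewrite leq_eqVlt => /predU1P[<-//|ij] ej1.
have [p pf] := IHj ij (executed_le _ _ (leqnSn j) ej1).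
have [_ scenE] := executed_adds j ej1.
by rewrite /master_feasible scenE; exact: pmp_feasible_rcons pf.
Qed.

Lemma cg_terminates (t0 : 'I_(nmom w)) (l0 : nat) (r : R) :
  0 < eps -> executed x eps c l0 -> master_feasible c l0 ->
  compact (sublevel t0 r) ->
  (forall l a, (l0 <= l)%N -> executed x eps c l -> supp w a ->
     r < mom w t0 a -> rho x c l a <= eps / 2) ->
  equicontinuous [set l | (l0 <= l)%N /\ executed x eps c l]
    (fun l (a : subspace (sublevel t0 r)) => rho x c l a) ->
  exists L, [/\ (l0 <= L)%N, executed x eps c L & stops_at x eps c L].
Proof.
move=> eps0 el0 fl0 cK out equi; apply: contrapT => never.
have nostop l : (l0 <= l)%N -> executed x eps c l -> ~ stops_at x eps c l.
  by move=> l0l el sl; apply: never; exists l.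
have exec l : (l0 <= l)%N -> executed x eps c l.
  elim: l => [|l IHl]; first by rewrite leqn0 => /eqP <-.
  rewrite leq_eqVlt => /predU1P[<-//|l0l] k.
  rewrite ltnS leq_eqVlt => /predU1P[->|kl]; last exact: IHl.
  by apply: nostop => //; exact: IHl.
have feas l : (l0 <= l)%N -> master_feasible c l.
  by move=> l0l; apply: master_feasible_le fl0 => //; exact: exec.
have [_ _ _ opt priced] := hrun.
have gain l : (l0 <= l)%N ->
    eps / 2 < rho x c l (column c l) /\ adds_column c l.
  move=> l0l; apply: priced; [exact: exec|exact: feas|].
  by apply: nostop => //; exact: exec.
(* A column priced above [eps / 2] cannot lie where [r < mom w t0 a], by [out]. *)
have inK l : (l0 <= l)%N -> sublevel t0 r (column c l).
  move=> l0l; have [rl [sl _]] := gain l l0l; split=> //.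
  rewrite leNgt; apply/negP => /(out l _ l0l (exec l l0l) sl).
  by rewrite leNgt rl.
(* The tolerance matches the gap: [rho] at iteration [j] exceeds [eps / 2] at column [j] and is at
   most 0 at the retained column [i]. *)
have eps20 : 0 < eps / 2 by rewrite divr_gt0.
have [i [j [l0i ij]]] :=
  equicontinuous_compact_pair _ _ _ _ _ (column c) l0 _ cK equi
  (fun l l0l => conj l0l (exec l l0l)) inK eps20.
have l0j : (l0 <= j)%N by rewrite (leq_trans l0i)// ltnW.
have [rj _] := gain j l0j.
have [_ [[dfeas _] _]] := opt j (exec j l0j) (feas j l0j).
have := dfeas _ (column_mem _ _ ij (exec j l0j)).
by move: rj; rewrite /rho /reduced_cost; lra.
Qed.

End Run.

(** * Near-optimality of the returned distribution *)

Theorem theorem11 (R : realType) (n M : nat) (X : set 'rV[R]_n)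
    (rw : 'I_M -> row_data R n) (t0 : forall m, 'I_(nmom (rw m)))
    (hreg : forall m, regularity (rw m) X)
    (htail : forall m, light_tail X (t0 m))
    (m : 'I_M) (x : 'rV[R]_n) (hx : X x) (eps : R) (heps : 0 < eps)
    (c : cg_trace (rw m)) (hrun : cg_run x eps c)
    (l0 : nat) (hl0 : executed x eps c l0) (hfeas : master_feasible c l0)
    (r : R) (hr : 0 < r)
    (hsup : (ereal_sup
               [set ereal_sup [set (rho x c l a)%:E |
                               a in [set a | supp (rw m) a /\ (r < mom (rw m) (t0 m) a)%R]]
               | l in [set l | (l0 <= l)%N /\ executed x eps c l]]
             <= (eps / 2)%:E)%E)
    (hequi : equicontinuous [set l | (l0 <= l)%N /\ executed x eps c l]
               (fun l (a : subspace (sublevel (t0 m) r)) => rho x c l a)) :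
  (forall s : R, 0 < s -> compact (sublevel (t0 m) s)) /\
  exists L : nat,
    [/\ (l0 <= L)%N, executed x eps c L, stops_at x eps c L &
        let P := pmp_measure (scen c L) (weight c L) in
        let omega := pmp_value (rw m) (scen c L) x in
        [/\ ambiguity (rw m) P,
            (Omega (rw m) x - (eps / 2)%:E <= omega)%E,
            omega = expected_reward (rw m) P x &
            (omega <= Omega (rw m) x)%E]].
Proof.
have [_ [_ csupp] rusc _ /(_ _ hx)[b0 [b [_ rbound]]]] := hreg m.
have cK s : compact (sublevel (t0 m) s).
  exact: compact_sublevel csupp (htail m).
split=> //.
have out l a : (l0 <= l)%N -> executed x eps c l -> supp (rw m) a ->
    r < mom (rw m) (t0 m) a -> rho x c l a <= eps / 2.
  move=> l0l el sa ra; rewrite -lee_fin; apply: le_trans hsup.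
  apply: (@le_trans _ _ (ereal_sup [set (rho x c l a')%:E |
      a' in [set a' | supp (rw m) a' /\ r < mom (rw m) (t0 m) a']])).
    by apply: ereal_sup_ubound; exists a.
  by apply: ereal_sup_ubound; exists l.
have [L [l0L eL stopL]] :=
  cg_terminates _ _ _ hrun _ _ _ heps hl0 hfeas (cK r) out hequi.
exists L; split=> //; move=> P omega.
have [feasL pspL] := stopL.
have [_ _ _ /(_ L eL feasL)[popt dopt] _] := hrun.
have ssupp := scen_supp _ _ _ hrun L eL.
have ambP : ambiguity (rw m) P.
  by apply: ambiguity_pmp_measure => //; case: popt.
have omegaE : omega = (pmp_obj (rw m) (scen c L) x (weight c L))%:E.
  exact: pmp_valueE.
have omegaP : omega = expected_reward (rw m) P x.
  rewrite omegaE /expected_reward integral_pmp_measure//.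
    exact: closed_measurable_rV.
  by apply: usc_measurable => //; exact: rusc.
split=> //; last by rewrite omegaP; apply: ereal_sup_ubound; exists P.
(* Moving [eps / 2] to the right leaves an upper bound to prove for each [Q] in the ambiguity set
   separately. *)
rewrite leeBlDr//; apply: ge_ereal_sup => _ [Q ambQ <-].
have rcd a : supp (rw m) a ->
    reduced_cost x (dual_a c L) (dual_b c L) a <= eps / 2.
  move=> sa; rewrite -lee_fin; apply: le_trans pspL.
  by apply: ereal_sup_ubound; exists a.
have beta0 t : 0 <= dual_b c L t by have [[]] := dopt.
apply: le_trans
  (weak_duality _ _ csupp ambQ _ _ _ _ _ _ (rusc _ hx) rbound beta0 rcd) _.
rewrite omegaE -EFinD lee_fin lerD2r.
(* The optimal weights do at least as well as the [q] of strong duality, whose objective reaches the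
   dual value. *)
have [q qfeas qobj] := pmp_strong_duality _ _ _ _ _ _ _ dopt.
by apply: le_trans qobj _; case: popt => _; apply.
Qed.
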